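(* There is a universal constant $C'>0$ such that the following holds. Let $p=0.5$, $\gamma>100\sqrt{\log n/n}$, and $c>0$ with $c\gamma<0.25$. There exists an adversary (corrupting at most $\gamma n$ nodes) such that, with probability at least $0.99$, the prune-then-median estimate that deletes $c\gamma n$ highest-degree and $c\gamma n$ lowest-degree nodes satisfies $|\hat p(\mathcal{A}(G))-p|\ge C'\gamma$, and the corresponding prune-then-mean estimate satisfies $|\hat p(\mathcal{A}(G))-p|\ge C'\gamma^2$, where $G\sim G(n,p)$.
   Context: $G(n,p)$ is the distribution over undirected graphs on $[n]$ with each edge present independently with probability $p$. An adversary chooses $B\subseteq[n]$ with $|B|\le\gamma n$ and may arbitrarily change the status of any edge with at least one endpoint in $B$, producing $\mathcal{A}(G)$. The prune-then-mean/median algorithm: remove the $c\gamma n$ nodes of largest degree and the $c\gamma n$ nodes of smallest degree (degrees in $\mathcal{A}(G)$); on the remaining induced graph $H$ with $m=(1-2c\gamma)n$ nodes output either $(\text{number of edges of }H)/\binom m2$ (mean) or $\mathrm{Median}\{\deg_H(v)\}/(m-1)$ (median).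
   Formalization: The corruption fraction is assumed to satisfy γ ≤ 1 (and n ≥ 1); without it the claim fails, since |p̂ − 1/2| ≤ 1/2 while γ could be arbitrarily large when c is tiny. The number cγn of pruned nodes is rounded down. *)

(* Defs.v *)
From mathcomp Require Import all_boot all_order all_algebra.
From mathcomp Require Import boolp reals exp.

Set Implicit Arguments.
Unset Strict Implicit.
Unset Printing Implicit Defensive.

Import Order.TTheory GRing.Theory Num.Theory.
Local Open Scope ring_scope.

Definition edge (n : nat) := {e : {set 'I_n} | #|e| == 2}.

Definition graph (n : nat) := {set edge n}.

Definition deg_in (n : nat) (G : graph n) (S : {set 'I_n}) (v : 'I_n) : nat :=
  #|[set e in G | (v \in val e) && (val e \subset S)]|.

Definition deg (n : nat) (G : graph n) (v : 'I_n) : nat := deg_in G setT v.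

Definition edges_in (n : nat) (G : graph n) (S : {set 'I_n}) : nat :=
  #|[set e in G | val e \subset S]|.

Definition gnp_mass (R : realType) (n : nat) (p : R) (G : graph n) : R :=
  \prod_(e : edge n) (if e \in G then p else 1 - p).

Definition gnp_prob (R : realType) (n : nat) (p : R) (E : graph n -> Prop) : R :=
  \sum_(G : graph n | `[< E G >]) gnp_mass p G.

(* The corrupted set B may depend on the sampled graph. *)
Definition node_adversary (R : realType) (n : nat) (gamma : R)
    (A : graph n -> graph n) : Prop :=
  forall G : graph n, exists B : {set 'I_n},
    #|B|%:R <= gamma * n%:R /\
    forall e : edge n, [disjoint val e & B] -> (e \in A G) = (e \in G).

(* T consists of k vertices of largest degree, L of k vertices of smallest
   degree; ties may be broken in any way, so S need not be unique. *)
Definition pruned (n : nat) (k : nat) (G : graph n) (S : {set 'I_n}) : Prop :=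
  exists T L : {set 'I_n},
    [/\ #|T| = k /\ #|L| = k,
        [disjoint T & L],
        forall u v, u \in T -> v \notin T -> (deg G v <= deg G u)%N,
        forall u v, u \in L -> v \notin L -> (deg G u <= deg G v)%N
      & S = ~: (T :|: L)].

(* Average of the two middle elements, which coincide when the size is odd. *)
Definition median (R : realType) (s : seq nat) : R :=
  let t := sort leq s in
  ((nth 0%N t (size s).-1./2)%:R + (nth 0%N t (size s)./2)%:R) / 2.

Definition mean_estimate (R : realType) (n : nat) (G : graph n)
    (S : {set 'I_n}) : R :=
  (edges_in G S)%:R / 'C(#|S|, 2)%:R.

Definition median_estimate (R : realType) (n : nat) (G : graph n)
    (S : {set 'I_n}) : R :=
  median R [seq deg_in G S v | v <- enum S] / (#|S|%:R - 1).

Lemma gnp_prob_total (R : realType) (n : nat) (p : R) :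
  gnp_prob p (fun _ : graph n => True) = 1.
Proof.
rewrite /gnp_prob /gnp_mass (eq_bigl predT); last by move=> G; rewrite asboolT.
rewrite -(bigA_distr _ _ (fun=> p) (fun=> 1 - p)) big1 // => e _.
by rewrite /= addrCA subrr addr0.
Qed.

Lemma pruned_exists (n k : nat) (G : graph n) :
  (k.*2 <= n)%N -> exists S, pruned k G S.
Proof.
move=> k2n.
have kn : (k <= n)%N by apply: leq_trans k2n; rewrite -addnn leq_addr.
pose le u v := (deg G u <= deg G v)%N.
have le_tot : total le by move=> u v; apply: leq_total.
have le_tr : transitive le by move=> u v w; apply: leq_trans.
pose s := sort le (enum 'I_n).
have us : uniq s by rewrite sort_uniq enum_uniq.
have ms v : v \in s by rewrite mem_sort mem_enum.
have ss : size s = n by rewrite size_sort size_enum_ord.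
have sle : sorted le s by apply: sort_sorted.
have cut j u v : u \in take j s -> v \in drop j s -> le u v.
  move: sle; rewrite -{1}(cat_take_drop j s) sorted_pairwise // pairwise_cat.
  by case/andP=> /allrelP h _; apply: h.
have splt j v : (v \in take j s) || (v \in drop j s).
  by rewrite -mem_cat cat_take_drop.
exists (~: ([set v in drop (n - k) s] :|: [set v in take k s])).
exists [set v in drop (n - k) s], [set v in take k s]; split => //.
- by rewrite !cardsE !(card_uniqP _) ?drop_uniq ?take_uniq // size_drop size_takel ss ?subKn.
- have : uniq (take (n - k) s ++ drop (n - k) s) by rewrite cat_take_drop.
  rewrite cat_uniq => /and3P[_ /hasPn h _].
  rewrite disjoint_subset; apply/subsetP => v; rewrite !inE => /h.
  apply: contra => vk; have kk : (k <= n - k)%N.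
    by rewrite leq_subRL // addnn.
  by move: vk; rewrite -(subnKC kk) takeD mem_cat => ->.
- move=> u v; rewrite !inE => ud vd; apply: cut ud.
  by move: (splt (n - k)%N v); rewrite (negPf vd) orbF.
- move=> u v; rewrite !inE => ut vt; apply: cut ut _.
  by move: (splt k v); rewrite (negPf vt).
Qed.

(* Main.v *)
Require Import Defs.
From mathcomp Require Import all_boot all_order all_algebra.
From mathcomp Require Import boolp reals sequences exp.
From mathcomp Require Import zify ring lra.
Set Implicit Arguments.
Unset Strict Implicit.
Unset Printing Implicit Defensive.
Import Order.TTheory GRing.Theory Num.Theory.
Local Open Scope ring_scope.

(** The adversary corrupts 4b vertices, with b close to gamma n / 20, and wires
    them so that every other vertex receives exactly 4b (set T), 3b (set P),
    b (set Q) or 0 (set L) corrupted neighbours, where |T| = |L| = k is the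
    pruning size, while the corrupted vertices themselves have degree near
    n / 2 and so survive the pruning. All degrees of the random part deviate
    from their mean by less than b / 2 (Chernoff), which is at most half of
    every gap between tiers, so the pruning removes exactly T and L and the
    surviving set does not depend on the random graph. Among the m = n - 2k
    survivors P is a strict majority, of degree at least (m + b) / 2, which
    moves the median by order gamma. The forced edges exceed half of the pairs
    meeting the corrupted set by order b ^ 2, while the number of random edges
    fluctuates by less, which moves the mean by order gamma ^ 2. *)

(** * Union bound and Chernoff bound for edge sets in G(n, 1/2) *)

(** The imbalance |X ∩ G| - |X \ G| is twice the deviation of |X ∩ G| from its mean |X| / 2. Adding
    [s] on one side avoids halves and truncated subtraction. *)
Definition deviates (n s : nat) (X : {set edge n}) (G : graph n) : Prop :=
  (s + #|X :\: G| <= #|X :&: G|)%N \/ (s + #|X :&: G| <= #|X :\: G|)%N.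

Lemma gnp_mass_ge0 (R : realType) (n : nat) (p : R) (G : graph n) :
  0 <= p -> p <= 1 -> 0 <= gnp_mass p G.
Proof.
by move=> p0 p1; apply: prodr_ge0 => e _; case: ifP; rewrite ?subr_ge0.
Qed.

Lemma gnp_prob_union (R : realType) (n : nat) (p : R) (I : finType)
    (Bad : I -> graph n -> Prop) (E : graph n -> Prop) :
  0 <= p -> p <= 1 ->
  (forall G, (forall i, ~ Bad i G) -> E G) ->
  1 - \sum_i gnp_prob p (Bad i) <= gnp_prob p E.
Proof.
move=> p0 p1 h; rewrite lerBlDr -(gnp_prob_total n p) /gnp_prob.
under [X in _ + X]eq_bigr do rewrite big_mkcond.
rewrite exchange_big big_mkcond [X in X + _]big_mkcond -big_split /=.
apply: ler_sum => G _; rewrite asboolT //.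
have m0 := gnp_mass_ge0 G p0 p1.
have s0 i : 0 <= (if `[< Bad i G >] then gnp_mass p G else 0) by case: ifP.
case: asboolP => [_|nE]; first by rewrite lerDl sumr_ge0.
have /existsNP[i /contrapT Bi] : ~ (forall i, ~ Bad i G) by move/h.
by rewrite add0r (bigD1 i) //= asboolT // lerDl sumr_ge0.
Qed.

(** By independence the expectation factors over the edges: an edge outside [X] contributes 1, an
    edge of [X] contributes (z + w) / 2. Two separate weights let both tails come from one identity,
    by swapping [z] and [w]. *)
Lemma gnp_half_mgf (R : realType) (n : nat) (X : {set edge n}) (z w : R) :
  \sum_(G : graph n) gnp_mass (1 / 2) G * (z ^+ #|X :&: G| * w ^+ #|X :\: G|)
  = ((z + w) / 2) ^+ #|X|.
Proof.
pose f e := if e \in X then z / 2 else 1 / 2.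
pose g e := if e \in X then w / 2 else 1 / 2.
transitivity (\sum_(G : graph n) \prod_e (if e \in G then f e else g e)).
  apply: eq_bigr => G _.
  rewrite -!prodr_const [\prod_(i in X :&: G) z]big_mkcond.
  rewrite [\prod_(i in X :\: G) w]big_mkcond /gnp_mass -!big_split /=.
  apply: eq_bigr => e _; rewrite /f /g !inE.
  by case: (e \in G); case: (e \in X); rewrite /=; field.
rewrite -bigA_distr -prodr_const [RHS]big_mkcond; apply: eq_bigr => e _.
by rewrite /f /g /=; case: (e \in X); field.
Qed.

(* Chernoff's method with weight [1 + d] instead of [expR t], so that
   [((1 + d) + (1 + d)^-1) / 2 <= 1 + d ^ 2 / 2] is elementary. *)
Lemma gnp_half_deviates (R : realType) (n s : nat) (X : {set edge n}) (d : R) :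
  0 <= d ->
  gnp_prob (1 / 2) (deviates s X)
    <= 2 * expR (#|X|%:R * (d ^+ 2 / 2) - s%:R * (d / (1 + d))).
Proof.
move=> d0; have h0 : 0 <= 1 / 2 :> R by lra.
have h1 : 1 / 2 <= 1 :> R by lra.
set z := 1 + d; have z0 : 0 < z by rewrite /z; lra.
have zn0 : z != 0 by rewrite gt_eqF.
have z1 : 1 <= z by rewrite /z; lra.
have zs0 : 0 < z ^+ s by rewrite exprn_gt0.
(* Here 1 / z = 1 - d / z <= exp (- d / z). *)
have vs : z^-1 ^+ s <= expR (- (s%:R * (d / z))).
  rewrite -mulrN expRM_natl lerXn2r ?nnegrE ?expR_ge0 ?invr_ge0 ?(ltW z0) //.
  apply: le_trans (expR_ge1Dx _); rewrite le_eqVlt; apply/orP; left; apply/eqP.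
  by rewrite /z; field; rewrite -/z.
have mg : ((z + z^-1) / 2) ^+ #|X| <= expR (#|X|%:R * (d ^+ 2 / 2)).
  rewrite expRM_natl lerXn2r ?nnegrE ?expR_ge0 //.
    by rewrite divr_ge0 // addr_ge0 ?invr_ge0 ?ltW.
  apply: le_trans (expR_ge1Dx _).
  have : z^-1 <= 1 - d + d ^+ 2.
    rewrite -[_^-1]mul1r ler_pdivrMr // /z.
    have -> : (1 - d + d ^+ 2) * (1 + d) = 1 + d ^+ 3 by ring.
    by rewrite lerDl exprn_ge0.
  by move: (z^-1) => y; rewrite /z; lra.
(* Markov's inequality for both tails at once: on the event, one of z^(a-b) and z^(b-a) is at least
   z^s, and both have the same expectation. *)
have key : gnp_prob (1 / 2) (deviates s X) * z ^+ s
    <= 2 * ((z + z^-1) / 2) ^+ #|X|.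
  have e1 := gnp_half_mgf X z z^-1.
  have e2 := gnp_half_mgf X z^-1 z; rewrite [z^-1 + z]addrC in e2.
  rewrite [2 * _]mulrDl [1 * (_ ^+ _)]mul1r -[X in _ <= X + _]e1 -[X in _ <= _ + X]e2 -big_split.
  rewrite /gnp_prob big_mkcond mulr_suml /=.
  apply: ler_sum => G _; rewrite -mulrDr.
  set a := #|_ :&: _|; set b := #|_ :\: _|.
  have m0 : 0 <= gnp_mass (1 / 2 : R) G by apply: gnp_mass_ge0.
  have p0 i j : 0 <= z ^+ i * z^-1 ^+ j.
    by rewrite mulr_ge0 // exprn_ge0 // ?invr_ge0 ltW.
  have up i j : (s + j <= i)%N -> z ^+ s <= z ^+ i * z^-1 ^+ j.
    move=> ij; rewrite exprVn ler_pdivlMr ?exprn_gt0 // -exprD.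
    by rewrite ler_weXn2l.
  case: asboolP => [dv|_]; last first.
    by rewrite mul0r mulr_ge0 // addr_ge0 // mulrC.
  rewrite ler_wpM2l //; case: dv => /up h; first by apply: le_trans h _; rewrite lerDl mulrC.
  by apply: le_trans h _; rewrite [X in X <= _]mulrC lerDr.
rewrite expRD; apply: le_trans (_ : 2 * ((z + z^-1) / 2) ^+ #|X| * z^-1 ^+ s <= _).
  by rewrite exprVn ler_pdivlMr.
rewrite mulrA ler_pM //.
- by rewrite mulr_ge0 // exprn_ge0 // divr_ge0 // addr_ge0 ?invr_ge0 ?ltW.
- by rewrite exprn_ge0 // invr_ge0 ltW.
- by rewrite ler_pM2l.
Qed.

(** * Adjacency, degrees and the handshake identity *)

Definition adj (n : nat) (G : graph n) (u v : 'I_n) : bool :=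
  [exists e in G, val e == [set u; v]].

Lemma edge_pair (n : nat) (u v : 'I_n) :
  u != v -> exists e : edge n, val e = [set u; v].
Proof.
move=> uv; have c : #|[set u; v]| == 2%N by rewrite cards2 uv.
by exists (exist (fun A : {set _} => #|A| == 2%N) _ c).
Qed.

Lemma edgeP (n : nat) (e : edge n) (v : 'I_n) :
  v \in val e -> exists2 u, u != v & val e = [set u; v].
Proof.
move=> ve; have /cards2P[a [b [ab eab]]] := valP e.
move: ve; rewrite eab !inE => /orP[]/eqP->; last by exists a.
by exists b; rewrite 1?eq_sym // setUC.
Qed.

Lemma adjE (n : nat) (G : graph n) (e : edge n) (u v : 'I_n) :
  val e = [set u; v] -> adj G u v = (e \in G).
Proof.
move=> ee; apply/exists_inP/idP => [[e' e'G /eqP ee']|eG].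
  by have -> : e = e' by apply: val_inj; rewrite ee ee'.
by exists e; rewrite // ee.
Qed.

(** Edges at [v] and neighbours of [v] are matched through the common image of e -> [val e] and u ->
    {u, v}, both injective. *)
Lemma deg_inE (n : nat) (G : graph n) (S : {set 'I_n}) (v : 'I_n) :
  v \in S -> deg_in G S v = #|[set u in S | (u != v) && adj G u v]|.
Proof.
move=> vS; rewrite /deg_in; set E := [set e in G | _]; set N := [set u in S | _].
have im : [set val e | e in E] = [set [set u; v] | u in N].
  apply/setP => A; apply/imsetP/imsetP => [[e]|[u]]; rewrite inE.
    case/and3P => eG ve eS ->; have [u uv ee] := edgeP ve; exists u => //.
    by rewrite inE uv (adjE _ ee) eG (subsetP eS) // ee !inE eqxx.
  case/and3P => uS uv; have [e ee] := edge_pair uv; rewrite (adjE _ ee) => eG ->.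
  exists e => //; rewrite !inE eG ee !inE eqxx orbT /=.
  by apply/subsetP => w; rewrite !inE => /orP[]/eqP->.
rewrite -(card_imset _ val_inj) im card_in_imset // => u w.
rewrite !inE => /and3P[_ uv _] /and3P[_ wv _] /setP/(_ u).
by rewrite !inE eqxx (negPf uv) !orbF => /esym/eqP.
Qed.

Lemma deg_in_notin (n : nat) (G : graph n) (S : {set 'I_n}) (v : 'I_n) :
  v \notin S -> deg_in G S v = 0%N.
Proof.
move=> vS; apply/eqP; rewrite cards_eq0; apply/eqP/setP => e; rewrite !inE.
by apply/negP => /and3P[_ ve /subsetP/(_ _ ve)]; apply/negP.
Qed.

(** Double counting of incidences. Summing over a larger [S] costs nothing, since degrees vanish
    outside [W]; this allows the random edges to be summed over the whole core. *)
Lemma sum_deg_in (n : nat) (G : graph n) (S W : {set 'I_n}) :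
  W \subset S -> (\sum_(v in S) deg_in G W v = (edges_in G W).*2)%N.
Proof.
move=> WS; transitivity (\sum_(v : 'I_n) deg_in G W v)%N.
  rewrite [RHS](bigID (mem S)) /= [X in (_ + X)%N]big1 ?addn0 // => v.
  by move/(contra (subsetP WS v)); apply: deg_in_notin.
rewrite /deg_in; under eq_bigr do rewrite -sum1_card big_mkcond.
rewrite exchange_big -muln2 /edges_in -sum_nat_const [RHS]big_mkcond /=.
apply: eq_bigr => e _; rewrite !inE; case: ifP => [/andP[eG eS]|nS].
  transitivity #|val e|; last exact/eqP/(valP e).
  rewrite -sum1_card [RHS]big_mkcond /=.
  by apply: eq_bigr => v _; rewrite !inE eG eS andbT.
by apply: big1 => v _; rewrite !inE; case: ifP => // /and3P[eG _ eS]; rewrite eG eS in nS.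
Qed.

(** * Edge sets whose imbalance controls degrees and edge counts *)

Definition star (n : nat) (v : 'I_n) (W : {set 'I_n}) : {set edge n} :=
  [set e : edge n | (v \in val e) && (val e \subset W)].

Definition clique (n : nat) (W : {set 'I_n}) : {set edge n} :=
  [set e : edge n | val e \subset W].

Lemma card_star (n : nat) (v : 'I_n) (W : {set 'I_n}) :
  v \in W -> #|star v W| = #|W|.-1.
Proof.
(* The star is the set of edges at [v] in the complete graph on [W]. *)
move=> vW; transitivity (deg_in setT W v).
  by apply: eq_card => e; rewrite !inE.
rewrite deg_inE // (cardsD1 v W) vW /=; apply: eq_card => u; rewrite !inE.
rewrite andbC; have [->|uv] := eqVneq u v => //=.
by have [e ee] := edge_pair uv; rewrite (adjE _ ee) inE.
Qed.

Lemma card_star_le (n : nat) (v : 'I_n) (W : {set 'I_n}) : (#|star v W| <= n)%N.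
Proof.
have [vW|vW] := boolP (v \in W).
  rewrite card_star //; apply: leq_trans (leq_pred _) _.
  by rewrite -[X in (_ <= X)%N](card_ord n) max_card.
rewrite (_ : star v W = set0) ?cards0 //; apply/setP => e; rewrite !inE.
by apply/negP => /andP[ve /subsetP/(_ _ ve)]; apply/negP.
Qed.

Lemma card_clique (n : nat) (W : {set 'I_n}) : #|clique W| = 'C(#|W|, 2).
Proof.
rewrite -cards_draws -(card_imset _ val_inj); apply: eq_card => A.
apply/imsetP/idP => [[e]|]; rewrite !inE; first by move=> eW ->; rewrite eW (valP e).
by case/andP => AW cA; exists (exist (fun A : {set _} => #|A| == 2%N) A cA); rewrite ?inE.
Qed.

Lemma deg_in_dev (n s : nat) (G : graph n) (W : {set 'I_n}) (v : 'I_n) :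
  v \in W -> ~ deviates s (star v W) G ->
  ((deg_in G W v).*2 < #|W|.-1 + s /\ #|W|.-1 < (deg_in G W v).*2 + s)%N.
Proof.
move=> vW; have <- := card_star vW; rewrite /deviates -(cardsID G (star v W)).
have -> : deg_in G W v = #|star v W :&: G|.
  by apply: eq_card => e; rewrite !inE andbC.
lia.
Qed.

Lemma edges_in_dev (n s : nat) (G : graph n) (W : {set 'I_n}) :
  ~ deviates s (clique W) G -> ('C(#|W|, 2) < (edges_in G W).*2 + s)%N.
Proof.
rewrite -card_clique /deviates -(cardsID G (clique W)).
have -> : edges_in G W = #|clique W :&: G|.
  by apply: eq_card => e; rewrite !inE andbC.
lia.
Qed.

(** * Order statistics and uniqueness of extremal sets *)

(** Were the entry at [i] below [x], the first i + 1 sorted entries would all be below [x], more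
    than the count permits. *)
Lemma nth_sort_ge (s : seq nat) (x i : nat) :
  (count (fun y => y < x) s <= i < size s)%N -> (x <= nth 0 (sort leq s) i)%N.
Proof.
case/andP=> ci si; rewrite leqNgt; apply/negP => lt; move: ci; apply/negP.
rewrite -ltnNge -(permP (permEl (perm_sort leq s))).
set t := sort leq s in lt *; have st : size t = size s by rewrite size_sort.
rewrite -(cat_take_drop i.+1 t) count_cat; apply: ltn_addr.
have : all (fun y => y < x)%N (take i.+1 t).
  apply/(all_nthP 0%N) => j; rewrite size_takel ?st // => ji; rewrite nth_take //.
  apply: leq_ltn_trans lt; apply: (sorted_leq_nth leq_trans leqnn) => //.
  - by rewrite sort_sorted //; apply: leq_total.
  - by rewrite inE st; lia.
  - by rewrite inE st.
by rewrite all_count size_takel ?st // => /eqP->.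
Qed.

Lemma median_ge (R : realType) (s : seq nat) (x : nat) :
  (0 < size s)%N -> (count (fun y => y < x)%N s <= (size s).-1./2)%N ->
  x%:R <= median R s.
Proof.
move=> s0 cs; rewrite /median.
have h1 : (x <= nth 0 (sort leq s) (size s).-1./2)%N by apply: nth_sort_ge; lia.
have h2 : (x <= nth 0 (sort leq s) (size s)./2)%N by apply: nth_sort_ge; lia.
have : x%:R <= (nth 0%N (sort leq s) (size s).-1./2)%:R :> R by rewrite ler_nat.
have : x%:R <= (nth 0%N (sort leq s) (size s)./2)%:R :> R by rewrite ler_nat.
lra.
Qed.

(** [A] is extremal up to ties, [B] with a strict gap. If they differed, equal sizes would give some
    u in A \ B and v in B \ A, which the two hypotheses compare in contradictory ways. *)
Lemma extremal_set_unique (T : finType) (r : rel T) (A B : {set T}) :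
  #|A| = #|B| ->
  (forall u v, u \in A -> v \notin A -> r v u) ->
  (forall u v, u \in B -> v \notin B -> ~~ r u v) -> A = B.
Proof.
move=> cAB hA hB; apply/eqP; rewrite eqEcard cAB leqnn andbT.
apply/negPn/negP => /subsetPn[u uA uB].
have /subsetPn[v vB vA] : ~~ (B \subset A).
  apply: contra uB => BA; have /eqP -> : B == A by rewrite eqEcard BA cAB leqnn.
  by [].
by move: (hB v u vB uB); rewrite hA.
Qed.

Lemma double_bin2 (m : nat) : ('C(m, 2).*2 + m = m * m)%N.
Proof. by elim: m => // m IH; rewrite binS bin1; lia. Qed.

(** * The attack and the degrees it forces *)

Definition itv (n a b : nat) : {set 'I_n} := [set i : 'I_n | (a <= i < b)%N].

Lemma card_itv (n a b : nat) : (b <= n)%N -> #|itv n a b| = (b - a)%N.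
Proof.
elim: b => [|b IH] bn.
  by apply/eqP; rewrite cards_eq0; apply/eqP/setP => i; rewrite !inE; lia.
have [ab|ba] := leqP a b; last first.
  rewrite (_ : itv n a b.+1 = set0) ?cards0; first lia.
  by apply/setP => i; rewrite !inE; lia.
have -> : itv n a b.+1 = Ordinal bn |: itv n a b.
  by apply/setP => i; rewrite !inE -val_eqE /=; lia.
rewrite cardsU1 !inE /= IH; lia.
Qed.

(* Vertices are ordered so that [0, 3b) and [3b, 4b) are the corrupted sets
   B1, B2, followed by T = [4b, 4b+k), P = [4b+k, 4b+h), Q = [4b+h, n-k) and
   L = [n-k, n). B1 is joined to B2, T, P and B2 to B2, T, Q. *)
Definition joined (n b k h i j : nat) : bool :=
  ((i < 3 * b) && (3 * b <= j < 4 * b + h)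
   || (3 * b <= i < 4 * b)
      && ((3 * b <= j < 4 * b + k) || (4 * b + h <= j < n - k)))%N.

(** [joined] is not symmetric, so both orders of the endpoints are tried. *)
Definition attack (n b k h : nat) (G : graph n) : graph n :=
  [set e : edge n | if [disjoint val e & itv n 0 (4 * b)] then e \in G
    else [exists u in val e, exists v in val e,
            (u != v) && joined n b k h u v]].

(** Written as a complement to match the shape of the surviving set in [pruned]. *)
Definition core (n b k : nat) : {set 'I_n} :=
  ~: (itv n (4 * b) (4 * b + k) :|: itv n (n - k) n).

(* Number of corrupted neighbours of the uncorrupted vertex [v]. *)
Definition tier (n b k h v : nat) : nat :=
  (if v < 4 * b + k then 4 * b else if v < 4 * b + h then 3 * b
   else if v < n - k then b else 0)%N.

Lemma tier_cases (n b k h v : nat) : (k <= h)%N -> (4 * b + h + k <= n)%N ->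
  (v < 4 * b + k)%N /\ tier n b k h v = (4 * b)%N \/
  (4 * b + k <= v < 4 * b + h)%N /\ tier n b k h v = (3 * b)%N \/
  (4 * b + h <= v < n - k)%N /\ tier n b k h v = b \/
  (n - k <= v)%N /\ tier n b k h v = 0%N.
Proof. by rewrite /tier; do 3?case: ltnP; lia. Qed.

Lemma adj_attack (n b k h : nat) (G : graph n) (u v : 'I_n) : u != v ->
  adj (attack b k h G) u v =
    if (4 * b <= u)%N && (4 * b <= v)%N then adj G u v
    else joined n b k h u v || joined n b k h v u.
Proof.
move=> uv; have [e ee] := edge_pair uv; rewrite !(adjE _ ee) inE.
have -> : [disjoint val e & itv n 0 (4 * b)] = (4 * b <= u)%N && (4 * b <= v)%N.
  rewrite disjoints_subset ee subUset !sub1set !inE; lia.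
case: ifP => // _; rewrite ee; apply/exists_inP/orP.
  move=> [x]; rewrite !inE => xe /exists_inP[y]; rewrite !inE => ye /andP[xy].
  case/orP: xe xy => /eqP->; case/orP: ye => /eqP->; rewrite ?eqxx //; auto.
case=> j; [exists u|exists v]; rewrite ?inE ?eqxx ?orbT //; apply/exists_inP.
  by exists v; rewrite ?uv // !inE eqxx orbT.
by exists u; rewrite ?j 1?eq_sym ?uv // !inE eqxx.
Qed.

Lemma deg_attack_good (n b k h : nat) (G : graph n) (S : {set 'I_n}) (v : 'I_n) :
  (k <= h)%N -> (4 * b + h + k <= n)%N ->
  itv n 0 (4 * b) \subset S -> v \in S -> (4 * b <= v)%N ->
  deg_in (attack b k h G) S v
    = (deg_in G (S :\: itv n 0 (4 * b)) v + tier n b k h v)%N.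
Proof.
move=> kh hn BS vS vb; have vB : v \notin itv n 0 (4 * b) by rewrite inE; lia.
rewrite !deg_inE // ?in_setD ?vB //.
rewrite -(cardsID (itv n 0 (4 * b))) addnC; congr (_ + _)%N.
  apply: eq_card => u; rewrite !inE.
  have [->|uv] := eqVneq u v; first by rewrite /= !andbF.
  by rewrite adj_attack // vb andbT /= -leqNgt; case: leqP.
(* The corrupted neighbours of [v] form an interval [a, c): all of [0, 4b), B1, B2 or nothing,
   according to the tier. *)
have [a [c [c4 <- jac]]] : exists a c, [/\ (c <= 4 * b)%N,
    (c - a)%N = tier n b k h v & forall u, (u < 4 * b)%N ->
    joined n b k h u v || joined n b k h v u = (a <= u < c)%N].
  rewrite /tier /joined; case: ltnP => v1; first by exists 0%N, (4 * b)%N; split; lia.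
  case: ltnP => v2; first by exists 0%N, (3 * b)%N; split; lia.
  case: ltnP => v3; first by exists (3 * b)%N, (4 * b)%N; split; lia.
  by exists 0%N, 0%N; split; lia.
rewrite -(@card_itv n); last lia.
apply: eq_card => u; rewrite !inE.
have [uB|uB] := leqP (4 * b)%N u; first by rewrite andbF; lia.
have uv : u != v by apply/eqP => uv; move: uB vb; rewrite uv; lia.
have uS : u \in S by apply: (subsetP BS); rewrite inE.
by rewrite uS uv adj_attack // leqNgt uB /= jac // andbT.
Qed.

Lemma deg_attack_B1 (n b k h : nat) (G : graph n) (S : {set 'I_n}) (v : 'I_n) :
  v \in S -> (v < 3 * b)%N ->
  deg_in (attack b k h G) S v = #|S :&: itv n (3 * b) (4 * b + h)|.
Proof.
move=> vS vb; rewrite deg_inE //; apply: eq_card => u; rewrite !inE.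
have [->|uv] := eqVneq u v; first by rewrite /=; lia.
have vb' : (4 * b <= v)%N = false by lia.
rewrite adj_attack // vb' andbF /= /joined; congr (_ && _); lia.
Qed.

Lemma deg_attack_B2 (n b k h : nat) (G : graph n) (S : {set 'I_n}) (v : 'I_n) :
  v \in S -> (3 * b <= v < 4 * b)%N -> 
  deg_in (attack b k h G) S v
    = #|S :&: (itv n 0 (4 * b + k) :|: itv n (4 * b + h) (n - k))|.-1.
Proof.
(* B2 is a clique, so the interval union contains [v] itself; hence the predecessor. *)
move=> vS vb; rewrite deg_inE // [in RHS](cardsD1 v) !inE vS /=.
rewrite (_ : (_ < _ + _)%N || _); last lia.
apply: eq_card => u; rewrite !inE andbCA.
have [->|uv] := eqVneq u v; first by [].
have vb' : (4 * b <= v)%N = false by lia.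
rewrite adj_attack // vb' andbF /= /joined; congr (_ && _); lia.
Qed.

Lemma core_itv (n b k : nat) : (4 * b + k.*2 <= n)%N ->
  core n b k = itv n 0 (4 * b) :|: itv n (4 * b + k) (n - k).
Proof.
move=> hn; apply/setP => i; rewrite !inE; have := ltn_ord i; lia.
Qed.

Lemma core_good (n b k : nat) : (4 * b + k.*2 <= n)%N ->
  core n b k :\: itv n 0 (4 * b) = itv n (4 * b + k) (n - k).
Proof.
move=> hn; apply/setP => i; rewrite !inE; have := ltn_ord i; lia.
Qed.

Lemma all_good (n b : nat) : setT :\: itv n 0 (4 * b) = itv n (4 * b) n.
Proof. by apply/setP => i; rewrite !inE; have := ltn_ord i; lia. Qed.

Lemma card_core (n b k : nat) : (4 * b + k.*2 <= n)%N ->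
  #|core n b k| = (n - k.*2)%N.
Proof.
move=> hn; rewrite core_itv // cardsU !card_itv ?leq_subr; [|lia..].
rewrite (_ : _ :&: _ = set0) ?cards0; first lia.
by apply/setP => i; rewrite !inE; lia.
Qed.

(** * Surviving set, median degree and edge count under the attack *)

(** Twice a degree exceeds n + 3b - 1 on T and is below n - 3b - 1 on L. Every other vertex,
    corrupted or not, lies strictly between; for B1, with doubled degree at most n + 2b + 2, this is
    where [2 < b] enters. Strict gaps make T and L unique. *)
Lemma pruned_attack (n b k : nat) (G : graph n) (S : {set 'I_n}) :
  (2 < b)%N -> (k <= n./2)%N -> (4 * b + n./2.+1 + k <= n)%N ->
  (forall v, ~ deviates b (star v (itv n (4 * b) n)) G) ->
  pruned k (attack b k n./2.+1 G) S -> S = core n b k.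
Proof.
move=> b2 kn hn dev [T [L [[cT cL] _ hT hL ->]]].
set A := attack _ _ _ _ in hT hL.
have tc v := @tier_cases n b k n./2.+1 v (leqW kn) hn.
have dg (v : 'I_n) : (4 * b <= v)%N ->
    ((deg A v).*2 < n - 4 * b - 1 + b + (tier n b k n./2.+1 v).*2
     /\ n - 4 * b - 1 + (tier n b k n./2.+1 v).*2 < (deg A v).*2 + b)%N.
  move=> vb; rewrite /deg deg_attack_good ?subsetT ?inE //; last lia.
  have vW : v \in itv n (4 * b) n by rewrite inE vb ltn_ord.
  have := deg_in_dev vW (dev v); rewrite all_good card_itv //; lia.
have dB1 (v : 'I_n) : (v < 3 * b)%N -> deg A v = (b + n./2.+1)%N.
  move=> vb; rewrite /deg deg_attack_B1 ?in_setT // setTI card_itv //; lia.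
have dB2 (v : 'I_n) : (3 * b <= v < 4 * b)%N -> deg A v = (n - n./2.+2)%N.
  move=> vb; rewrite /deg deg_attack_B2 ?in_setT // setTI cardsU !card_itv; [|lia..].
  rewrite (_ : _ :&: _ = set0) ?cards0; first lia.
  by apply/setP => i; rewrite !inE; lia.
congr (~: (_ :|: _)).
- apply: (@extremal_set_unique _ (fun v u => deg A v <= deg A u)%N) => //.
    by rewrite cT card_itv; lia.
  move=> u v; rewrite !inE -ltnNge => ub vb; have un := ltn_ord u.
  have [vb4|vb4] := leqP (4 * b)%N v.
    have := tc u; have := tc v; have := dg _ vb4; have := dg u ltac:(lia); lia.
  have := tc u; have := dg u ltac:(lia).
  have [vb3|vb3] := leqP (3 * b)%N v; [rewrite (dB2 v)|rewrite (dB1 v)]; lia.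
- apply: (@extremal_set_unique _ (fun v u => deg A u <= deg A v)%N) => //.
    by rewrite cL card_itv; lia.
  move=> u v; rewrite !inE -ltnNge => ub vb; have vn := ltn_ord v.
  have [vb4|vb4] := leqP (4 * b)%N v.
    have := tc u; have := tc v; have := dg _ vb4; have := dg u ltac:(lia); lia.
  have := tc u; have := dg u ltac:(lia).
  have [vb3|vb3] := leqP (3 * b)%N v; [rewrite (dB2 v)|rewrite (dB1 v)]; lia.
Qed.

Lemma median_attack (R : realType) (n b k : nat) (G : graph n) :
  (2 < b)%N -> (k <= n./2)%N -> (4 * b + n./2.+1 + k <= n)%N ->
  (forall v, ~ deviates b (star v (itv n (4 * b + k) (n - k))) G) ->
  (n - k.*2 + b)%:R / 2
    <= median R [seq deg_in (attack b k n./2.+1 G) (core n b k) v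
                | v <- enum (core n b k)].
Proof.
move=> b2 kn hn dev; have hk : (4 * b + k.*2 <= n)%N by lia.
set s := map _ _; have ss : size s = (n - k.*2)%N.
  by rewrite size_map -cardE card_core.
(* A vertex of P has doubled degree above (m - 4b - 1) - b + 6b = m + b - 1, where m = n - 2k, hence
   degree at least [uphalf (m + b)]. *)
apply: (@le_trans _ _ (uphalf (n - k.*2 + b))%:R).
  rewrite ler_pdivrMr // -natrM ler_nat; lia.
apply: median_ge; rewrite ss; first lia.
rewrite count_map -size_filter.
(* Only B1, B2 and Q can fall below the threshold. With h = [n./2.+1] they number exactly floor ((m
   - 1) / 2), the lower middle index. *)
apply: leq_trans (_ : #|itv n 0 (4 * b) :|: itv n (4 * b + n./2.+1) (n - k)| <= _)%N.
  rewrite cardE; apply: uniq_leq_size; first by rewrite filter_uniq ?enum_uniq.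
  move=> v; rewrite mem_filter !mem_enum => /andP[/= lt vC].
  move: lt; apply: contraLR; rewrite !inE -leqNgt => nv.
  have vC' : v \in itv n 0 (4 * b) :|: itv n (4 * b + k) (n - k) by rewrite -core_itv.
  move: vC'; rewrite !inE => vC'.
  have vW : v \in itv n (4 * b + k) (n - k) by rewrite inE; lia.
  rewrite deg_attack_good //; [|lia| |lia]; last first.
    by rewrite core_itv // subsetUl.
  rewrite core_good //; have := deg_in_dev vW (dev v); rewrite card_itv; last lia.
  have := @tier_cases n b k n./2.+1 v (leqW kn) hn; lia.
rewrite cardsU !card_itv; lia.
Qed.

Lemma sum_mem_const (T : finType) (A : {set T}) (c : nat) :
  (\sum_v (v \in A) * c = #|A| * c)%N.
Proof.
by rewrite -sum_nat_const [RHS]big_mkcond; apply: eq_bigr => v _; case: ifP; rewrite ?mul1n.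
Qed.

(** Compare with density one half. Pairs joining corrupted vertices to P or Q have densities 3/4 and
    1/4 and gain b (|P| - |Q|) >= 4 b^2; pairs inside the corrupted set lose at most b^2 / 2; the
    random edges lose less than b^2. The surplus is thus at least 2 b^2 edges. *)
Lemma edges_attack (n b k : nat) (G : graph n) :
  (2 < b)%N -> (k <= n./2)%N -> (4 * b + n./2.+1 + k <= n)%N ->
  ~ deviates (2 * b ^ 2) (clique (itv n (4 * b + k) (n - k))) G ->
  (2 * 'C(n - k.*2, 2) + 8 * b ^ 2
    <= 4 * edges_in (attack b k n./2.+1 G) (core n b k))%N.
Proof.
move=> b2 kn hn /edges_in_dev dev; have hk : (4 * b + k.*2 <= n)%N by lia.
set A := attack _ _ _ _; set W := itv n (4 * b + k) (n - k) in dev.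
have nW v : v \notin core n b k -> v \notin W.
  by apply: contra; rewrite core_itv // !inE => ->; rewrite orbT.
have BC : itv n 0 (4 * b) \subset core n b k by rewrite core_itv // subsetUl.
pose h := n./2.+1.
(* Indicators of the blocks B1, B2, P, Q turn the degree sum into products of block sizes and forced
   degrees. *)
have dC v : v \in core n b k -> deg_in A (core n b k) v = (deg_in G W v
    + ((v \in itv n 0 (3 * b)) * (b + h - k)
    + (v \in itv n (3 * b) (4 * b)) * (n - k - h - 1)
    + (v \in itv n (4 * b + k) (4 * b + h)) * (3 * b)
    + (v \in itv n (4 * b + h) (n - k)) * b))%N.
  move=> vC; have [vb|vb] := leqP (4 * b)%N v.
    rewrite deg_attack_good // ?core_good //; [|lia]; congr (_ + _)%N.
    have := @tier_cases n b k n./2.+1 v (leqW kn) hn.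
    by move: vC; rewrite core_itv // !inE -/h; lia.
  have vW : v \notin W by rewrite inE; lia.
  rewrite (deg_in_notin _ vW) !inE; have [v3|v3] := leqP (3 * b)%N v.
    rewrite deg_attack_B2 //; last lia.
    have -> : core n b k :&: (itv n 0 (4 * b + k) :|: itv n (4 * b + n./2.+1) (n - k))
        = itv n 0 (4 * b) :|: itv n (4 * b + h) (n - k).
      by rewrite core_itv //; apply/setP => i; rewrite !inE /h; lia.
    rewrite cardsU (_ : _ :&: _ = set0) ?cards0 ?card_itv; [|lia..|].
      by rewrite /h; lia.
    by apply/setP => i; rewrite !inE; lia.
  rewrite deg_attack_B1 //.
  have -> : core n b k :&: itv n (3 * b) (4 * b + n./2.+1)
      = itv n (3 * b) (4 * b) :|: itv n (4 * b + k) (4 * b + h).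
    by rewrite core_itv //; apply/setP => i; rewrite !inE /h; lia.
  rewrite cardsU (_ : _ :&: _ = set0) ?cards0 ?card_itv; [|lia..|].
    by rewrite /h; lia.
  by apply/setP => i; rewrite !inE; lia.
have := sum_deg_in A (subxx (core n b k)).
rewrite (eq_bigr _ dC) big_split /= (sum_deg_in G); last first.
  by apply/subsetP => v; apply: contraLR; apply: nW.
rewrite [X in (_ + X)%N]big_mkcond /=.
under [X in (_ + X)%N]eq_bigr => v _.
  rewrite (_ : (if _ then _ else _) = ((v \in itv n 0 (3 * b)) * (b + h - k)
    + (v \in itv n (3 * b) (4 * b)) * (n - k - h - 1)
    + (v \in itv n (4 * b + k) (4 * b + h)) * (3 * b)
    + (v \in itv n (4 * b + h) (n - k)) * b)%N); last first.
    by case: ifP => //; rewrite core_itv // !inE /h; lia.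
  over.
rewrite !big_split /= !sum_mem_const !card_itv /h; [|lia..].
move: dev; rewrite card_itv; last lia.
pose q := (n - k - (4 * b + n./2.+1))%N; pose p := (n./2.+1 - k)%N.
rewrite (_ : n - k - (4 * b + k) = p + q)%N; last by rewrite /p /q; lia.
rewrite (_ : b + n./2.+1 - k = b + p)%N; last by rewrite /p; lia.
rewrite (_ : n - k - n./2.+1 - 1 = 4 * b + q - 1)%N; last by rewrite /q; lia.
rewrite (_ : 4 * b + n./2.+1 - (4 * b + k) = p)%N; last by rewrite /p; lia.
rewrite -/q (_ : n - k.*2 = 4 * b + p + q)%N; last by rewrite /p /q; lia.
have pq : (4 * b + q + 1 <= p)%N by rewrite /p /q; lia.
(* The nonlinear facts are supplied by hand, so that [lia] only has to combine monomials
   linearly. *)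
have : (b * (4 * b + q + 1) <= b * p)%N by rewrite leq_mul2l pq orbT.
have := double_bin2 (p + q); have := double_bin2 (4 * b + p + q).
have : (b * (4 * b + q - 1) + b = b * (4 * b + q))%N by rewrite -mulnSr; congr (_ * _)%N; lia.
move: (4 * b + q - 1)%N 'C(_, 2) 'C(_, 2) (edges_in _ _) (edges_in _ _).
rewrite -!mulnn; clearbody p q; clear - b2; lia.
Qed.

(** * Failure probabilities of single events *)

(** An exponent of -2 ln n is the target because about 2n events enter the final union bound. *)
Lemma deviates_le (R : realType) (n s : nat) (X : {set edge n}) (d : R) :
  (0 < n)%N -> 0 <= d ->
  #|X|%:R * (d ^+ 2 / 2) - s%:R * (d / (1 + d)) <= - (2 * ln n%:R) ->
  gnp_prob (1 / 2) (deviates s X) <= 2 / n%:R ^+ 2 :> R.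
Proof.
move=> n0 d0 h; apply: le_trans (gnp_half_deviates s X d0) _.
rewrite ler_pM2l //; apply: le_trans (_ : expR (- (2 * ln n%:R)) <= _).
  by rewrite ler_expR.
by rewrite expRN expRM_natl lnK ?posrE ?ltr0n.
Qed.

Lemma deviates_linear (R : realType) (n b : nat) (X : {set edge n}) :
  (0 < n)%N -> (#|X| <= n)%N -> (20 * b <= n)%N ->
  8 * n%:R * ln n%:R <= b%:R ^+ 2 :> R ->
  gnp_prob (1 / 2) (deviates b X) <= 2 / n%:R ^+ 2 :> R.
Proof.
move=> n0 Xn bn Lb; have N0 : 0 < n%:R :> R by rewrite ltr0n.
have XN : #|X|%:R <= n%:R :> R by rewrite ler_nat.
have BN : 20 * b%:R <= n%:R :> R by rewrite -natrM ler_nat.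
move: Lb XN BN N0; set N : R := n%:R; set B : R := b%:R; set L := ln N.
set x : R := #|X|%:R => Lb XN BN N0.
have Nn0 : N != 0 by rewrite gt_eqF.
pose d := B / (2 * N).
have dE : B = 2 * N * d by rewrite /d; field.
have d0 : 0 <= d by rewrite /d divr_ge0 ?mulr_ge0 ?ler0n // ltW.
have d1 : d <= 1 / 40.
  by rewrite /d ler_pdivrMr; last lra; lra.
apply: (@deviates_le _ _ _ _ d) => //; rewrite -/x -/B -/N -/L.
have dd : 40 / 41 * d <= d / (1 + d).
  rewrite ler_pdivlMr; last lra.
  have := mulr_ge0 d0 (_ : 0 <= 1 / 40 - d); rewrite subr_ge0 => /(_ d1); lra.
have h1 : x * (d ^+ 2 / 2) <= N * (d ^+ 2 / 2).
  by rewrite ler_wpM2r // divr_ge0 // exprn_ge0.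
have h2 : B * (40 / 41 * d) <= B * (d / (1 + d)) by rewrite ler_wpM2l // ler0n.
have h3 : 2 * L <= N * d ^+ 2.
  rewrite -(ler_pM2l N0); move: Lb; rewrite dE.
  have -> : (2 * N * d) ^+ 2 = 4 * (N * (N * d ^+ 2)) by ring.
  lra.
have h4 : B * (40 / 41 * d) = 80 / 41 * (N * d ^+ 2) by rewrite dE; field.
have h5 : 0 <= N * d ^+ 2 by rewrite mulr_ge0 ?exprn_ge0 // ltW.
have h6 : N * (d ^+ 2 / 2) = 1 / 2 * (N * d ^+ 2) by field.
lra.
Qed.

Lemma deviates_quadratic (R : realType) (n b : nat) (X : {set edge n}) :
  (0 < n)%N -> (#|X| <= n ^ 2)%N -> 1 / 2 <= ln n%:R :> R ->
  8 * n%:R * ln n%:R <= b%:R ^+ 2 :> R ->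
  gnp_prob (1 / 2) (deviates (2 * b ^ 2) X) <= 2 / n%:R ^+ 2 :> R.
Proof.
move=> n0 Xn L1 Lb; have N1 : 1 <= n%:R :> R by rewrite ler1n.
have XN : #|X|%:R <= n%:R ^+ 2 :> R by rewrite -natrX ler_nat.
have N0 : 0 < n%:R :> R by rewrite ltr0n.
(* As |X| <= n^2, d = 1 / n keeps the quadratic term at most 1/2, while the linear term 2 b^2 / (n +
   1) is at least 8 ln n. *)
apply: (@deviates_le _ _ _ _ n%:R^-1) => //; first by rewrite invr_ge0 ltW.
rewrite natrM natrX.
move: L1 Lb XN N0 N1; set N : R := n%:R; set B : R := b%:R; set L := ln N.
set x : R := #|X|%:R => L1 Lb XN N0 N1.
have Nn0 : N != 0 by rewrite gt_eqF.
have -> : N^-1 / (1 + N^-1) = (1 + N)^-1 by field; rewrite Nn0 /= addrC gt_eqF //; lra.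
have h1 : x * (N^-1 ^+ 2 / 2) <= 1 / 2.
  rewrite mulrA ler_pM2r ?invr_gt0 // exprVn ler_pdivrMr ?exprn_gt0 //; lra.
have h2 : 8 * L <= 2 * B ^+ 2 * (1 + N)^-1.
  rewrite ler_pdivlMr; last lra.
  have : L * 1 <= L * N by rewrite ler_wpM2l //; lra.
  lra.
lra.
Qed.

(** * Errors of the two estimates under the attack *)

Lemma median_estimate_attack (R : realType) (n b k : nat) (G : graph n) :
  (2 < b)%N -> (k <= n./2)%N -> (4 * b + n./2.+1 + k <= n)%N ->
  (forall v, ~ deviates b (star v (itv n (4 * b + k) (n - k))) G) ->
  b%:R / (2 * n%:R)
    <= median_estimate R (attack b k n./2.+1 G) (core n b k) - 1 / 2.
Proof.
move=> b2 kn hn dev; rewrite /median_estimate.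
have := median_attack R b2 kn hn dev; move: (median _ _) => x hx.
rewrite card_core; last lia.
have m1 : 1 < (n - k.*2)%:R :> R by rewrite ltr1n; lia.
have mn : (n - k.*2)%:R <= n%:R :> R by rewrite ler_nat; lia.
have b0 : 0 <= b%:R :> R by rewrite ler0n.
move: hx m1 mn b0; rewrite natrD.
move: (_ - _)%:R n%:R b%:R => m N B hx m1 mn b0.
apply: le_trans (_ : B / (2 * (m - 1)) <= _).
  by rewrite ler_wpM2l // lef_pV2 ?posrE; lra.
rewrite lerBrDr ler_pdivlMr; last lra.
have mn0 : m - 1 != 0 by rewrite gt_eqF //; lra.
have -> : (B / (2 * (m - 1)) + 1 / 2) * (m - 1) = B / 2 + (m - 1) / 2 by field.
lra.
Qed.

Lemma mean_estimate_attack (R : realType) (n b k : nat) (G : graph n) :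
  (2 < b)%N -> (k <= n./2)%N -> (4 * b + n./2.+1 + k <= n)%N ->
  ~ deviates (2 * b ^ 2) (clique (itv n (4 * b + k) (n - k))) G ->
  2 * (b%:R / n%:R) ^+ 2
    <= mean_estimate R (attack b k n./2.+1 G) (core n b k) - 1 / 2.
Proof.
move=> b2 kn hn dev; rewrite /mean_estimate.
have := edges_attack b2 kn hn dev; rewrite card_core; last lia.
move: (edges_in _ _) => e he.
have c0 : 0 < 'C(n - k.*2, 2)%:R :> R by rewrite ltr0n bin_gt0; lia.
have cn : 'C(n - k.*2, 2)%:R <= n%:R ^+ 2 :> R.
  rewrite -natrX ler_nat -mulnn; have := double_bin2 (n - k.*2).
  have : ((n - k.*2) * (n - k.*2) <= n * n)%N by rewrite leq_mul //; lia.
  lia.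
have eC : 2 * 'C(n - k.*2, 2)%:R + 8 * b%:R ^+ 2 <= 4 * e%:R :> R.
  by rewrite -natrX -!natrM -natrD ler_nat.
move: c0 cn eC; move: 'C(_, _)%:R e%:R => C E c0 cn eC.
apply: le_trans (_ : 2 * (b%:R ^+ 2 / C) <= _).
  rewrite expr_div_n ler_pM2l // ler_wpM2l ?exprn_ge0 ?ler0n // lef_pV2 ?posrE //.
  exact: lt_le_trans cn.
rewrite lerBrDr ler_pdivlMr //; have Cn0 : C != 0 by rewrite gt_eqF.
have -> : (2 * (b%:R ^+ 2 / C) + 1 / 2) * C = 2 * b%:R ^+ 2 + C / 2 by field.
lra.
Qed.

Lemma node_adversary_attack (R : realType) (n b k h : nat) (gamma : R) :
  (4 * b <= n)%N -> (4 * b)%:R <= gamma * n%:R ->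
  node_adversary gamma (@attack n b k h).
Proof.
move=> bn bg G; exists (itv n 0 (4 * b)); split; first by rewrite card_itv // subn0.
by move=> e; rewrite inE => ->.
Qed.

(** * The one-vertex case and the choice of parameters *)

Lemma graph_one_vertex (G : graph 1) : G = set0.
Proof.
apply/setP => e; have := max_card (mem (val e)).
by rewrite (eqP (valP e)) card_ord.
Qed.

(** For n = 1 the logarithm vanishes and every positive gamma is allowed. With no edges both
    numerators are 0, so the estimates are 0 even over a zero denominator, an error of 1/2. *)
Lemma estimates_one_vertex (R : realType) (G : graph 1) (S : {set 'I_1}) :
  median_estimate R G S = 0 /\ mean_estimate R G S = 0.
Proof.
split; last first.
  rewrite /mean_estimate (_ : edges_in G S = 0%N) ?mul0r //.
  by apply/eqP; rewrite cards_eq0; apply/eqP/setP => e; rewrite (graph_one_vertex G) !inE.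
rewrite /median_estimate /median.
set s := map _ _.
have s0 i : nth 0%N (sort leq s) i = 0%N.
  have [iS|] := ltnP i (size (sort leq s)); last exact: nth_default.
  have : nth 0%N (sort leq s) i \in s by rewrite -(mem_sort leq) mem_nth.
  case/mapP => v _ ->; apply/eqP; rewrite cards_eq0; apply/eqP/setP => e.
  by rewrite (graph_one_vertex G) !inE.
by rewrite !s0 addr0 !mul0r.
Qed.

Lemma parameter_bounds (R : realType) (n : nat) (gamma : R) :
  (1 < n)%N -> 100 * Num.sqrt (ln n%:R / n%:R) < gamma -> gamma <= 1 ->
  let b := Num.truncn (gamma * n%:R / 20) in
  [/\ 1000 < n%:R :> R, 1 / 2 <= ln n%:R :> R, (2 < b)%N, (20 * b <= n)%N
    & [/\ 20 * b%:R <= gamma * n%:R, gamma / 21 <= b%:R / n%:R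
        & 8 * n%:R * ln n%:R <= b%:R ^+ 2 :> R]].
Proof.
move=> n1 hg g1 b.
have N2 : 2 <= n%:R :> R by rewrite ler_nat.
have L1 : 1 / 2 <= ln n%:R :> R.
  apply: le_trans (_ : ln 2 <= _); last by rewrite ler_ln ?posrE //; lra.
  rewrite -[1 / 2]expRK ler_ln ?posrE ?expR_gt0 //.
  have := expR_ge1Dx (- (1 / 2) : R); rewrite expRN => h.
  rewrite -lef_pV2 ?posrE ?expR_gt0 //; lra.
move: hg N2 L1; set N : R := n%:R; set L := ln N => hg N2 L1.
have N0 : 0 < N by lra.
have Nn0 : N != 0 by rewrite gt_eqF.
set x := Num.sqrt (L / N) in hg.
have x0 : 0 <= x by apply: sqrtr_ge0.
have xx : x ^+ 2 = L / N by rewrite sqr_sqrtr // divr_ge0 //; lra.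
have xL : x ^+ 2 * N = L by rewrite xx; field.
have x1 : x ^+ 2 <= (1 / 100) ^+ 2 by rewrite lerXn2r ?nnegrE //; lra.
have N3 : 1000 < N.
  rewrite ltNge; apply/negP => N3.
  have : x ^+ 2 * N <= (1 / 100) ^+ 2 * N by rewrite ler_wpM2r //; lra.
  rewrite xL; lra.
(* y = sqrt (n ln n), so gamma n > 100 y and b > 5 y - 1 >= 4 y. *)
have [y yE] : exists y, y = x * N by exists (x * N).
have y0 : 0 <= y by rewrite yE mulr_ge0 // ltW.
have yy : y ^+ 2 = N * L by rewrite -xL yE; ring.
have NL : 500 <= N * L.
  have : N * (1 / 2) <= N * L by rewrite ler_wpM2l //; lra.
  lra.
(* This gives gamma n > 2200, so rounding down in [b] costs less than passing from gamma n / 20 to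
   gamma n / 21. *)
have y22 : 22 <= y.
  rewrite leNgt; apply/negP => y22.
  have : y ^+ 2 <= 22 ^+ 2 by rewrite lerXn2r ?nnegrE //; lra.
  lra.
have gy : 100 * y < gamma * N.
  by rewrite yE mulrA ltr_pM2r.
have gN : gamma * N <= N by rewrite ler_piMl // ltW.
have g0 : 0 <= gamma * N / 20 by rewrite divr_ge0 //; lra.
have /andP[bl bu] := truncn_itv g0; rewrite -/b -[b.+1%:R]natr1 in bl bu.
have b4 : 4 * y <= b%:R by lra.
have bb : (4 * y) ^+ 2 <= b%:R ^+ 2 by rewrite lerXn2r ?nnegrE //; lra.
have b16 : 16 * (N * L) <= b%:R ^+ 2 by rewrite -yy; lra.
split=> //.
- by rewrite -(ltr_nat R); lra.
- by rewrite -(ler_nat R) natrM -/N; lra.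
split; [lra| |lra].
by rewrite ler_pdivlMr // mulrAC; lra.
Qed.

Lemma layer_sizes (n b k : nat) :
  (50 < n)%N -> (20 * b <= n)%N -> (4 * k < n)%N ->
  [/\ (k <= n./2)%N, (4 * b <= n)%N & (4 * b + n./2.+1 + k <= n)%N].
Proof. by split; lia. Qed.

Lemma card_clique_le (n : nat) (W : {set 'I_n}) : (#|clique W| <= n ^ 2)%N.
Proof.
have := double_bin2 #|W|; have := max_card (mem W); rewrite card_ord => Wn.
have : (#|W| * #|W| <= n * n)%N by rewrite leq_mul.
rewrite card_clique -mulnn; lia.
Qed.

(** * Combination of the bounds *)

Theorem theorem3p4 (R : realType) :
  exists C' : R, 0 < C' /\
    forall (n : nat) (gamma c : R),
      (0 < n)%N ->
      100 * Num.sqrt (ln n%:R / n%:R) < gamma ->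
      gamma <= 1 ->
      0 < c ->
      c * gamma < 1 / 4 ->
      exists A : graph n -> graph n,
        node_adversary gamma A /\
        99 / 100 <= gnp_prob (1 / 2 : R) (fun G : graph n =>
          forall S : {set 'I_n},
            pruned (Num.truncn (c * gamma * n%:R)) (A G) S ->
            C' * gamma <= `|median_estimate R (A G) S - 1 / 2| /\
            C' * gamma ^+ 2 <= `|mean_estimate R (A G) S - 1 / 2|).
Proof.
have h0 : 0 <= 1 / 2 :> R by lra.
have h1 : 1 / 2 <= 1 :> R by lra.
(* Ample room: the errors obtained are at least gamma / 42 and 2 gamma^2 / 441, or 1/2 when n =
   1. *)
exists (1 / 1000); split; first lra.
move=> n gamma c n0 hg g1 c0 cg.
have g0 : 0 < gamma by apply: le_lt_trans hg; rewrite mulr_ge0 // sqrtr_ge0.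
have [n1|n1] := leqP n 1.
  have {n1 n0} n1 : n = 1%N by apply/eqP; rewrite eqn_leq n1.
  subst n; exists id; split.
    by move=> G; exists set0; split => //; rewrite cards0 mulr_ge0 // ltW.
  apply: le_trans (gnp_prob_union (Bad := fun _ : void => fun=> False) h0 h1 _).
    by rewrite big1 //; lra.
  move=> G _ S _.
  have [-> ->] := estimates_one_vertex R G S.
  have gg : gamma ^+ 2 <= 1 by rewrite exprn_ile1 // ltW.
  by rewrite sub0r normrN ger0_norm //; split; lra.
have := parameter_bounds n1 hg g1.
move: (Num.truncn (gamma * n%:R / 20)) => b [N3 L1 b2 bn [bg gb Lb]].
have n3 : (50 < n)%N by rewrite -(ltr_nat R); lra.
have N0 : 0 < n%:R :> R by rewrite ltr0n.
have : (4 * Num.truncn (c * gamma * n%:R) < n)%N.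
  have q0 : 0 <= c * gamma * n%:R by rewrite !mulr_ge0 // ltW.
  have /andP[kl _] := truncn_itv q0.
  have : c * gamma * n%:R < 1 / 4 * n%:R by rewrite ltr_pM2r.
  rewrite -(ltr_nat R) natrM; lra.
move: (Num.truncn (c * gamma * n%:R)) => k kn.
have [kh b4n hn] := layer_sizes n3 bn kn.
exists (@attack n b k n./2.+1); split.
  apply: node_adversary_attack => //.
  by apply: le_trans bg; rewrite natrM ler_wpM2r ?ler0n // ler_nat.
pose W := itv n (4 * b + k) (n - k).
(* One star per vertex for the pruning, one for the median, and one clique for the mean. As [W] is
   fixed before sampling, these 2n + 1 events suffice, with no union over possible surviving
   sets. *)
pose Bad (i : option (bool * 'I_n)) : graph n -> Prop := match i with
  | None => deviates (2 * b ^ 2) (clique W)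
  | Some (true, v) => deviates b (star v (itv n (4 * b) n))
  | Some (false, v) => deviates b (star v W) end.
have P1 i : gnp_prob (1 / 2) (Bad i) <= 2 / n%:R ^+ 2 :> R.
  case: i => [[[] v]|] /=; try by apply: deviates_linear => //; apply: card_star_le.
  by apply: deviates_quadratic => //; apply: card_clique_le.
apply: le_trans (gnp_prob_union (Bad := Bad) h0 h1 _); last first.
  move=> G good S pS.
  have -> : S = core n b k.
    by apply: pruned_attack pS => // v; apply: (good (Some (true, v))).
  have := median_estimate_attack R b2 kh hn (fun v => good (Some (false, v))).
  have := mean_estimate_attack R b2 kh hn (good None).
  move: (mean_estimate _ _ _) (median_estimate _ _ _) => x y hx hy.
  have gb2 : (gamma / 21) ^+ 2 <= (b%:R / n%:R) ^+ 2.
    by rewrite lerXn2r ?nnegrE ?divr_ge0 ?ler0n // ltW.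
  have g20 : 0 <= gamma ^+ 2 by rewrite exprn_ge0 // ltW.
  split.
    apply: le_trans (ler_norm _); apply: le_trans hy.
    by rewrite invfM mulrCA; lra.
  apply: le_trans (ler_norm _); apply: le_trans hx.
  by rewrite expr_div_n in gb2; lra.
(* The total failure probability (2n + 1) * 2 / n^2 is at most 1/100 because n > 1000. *)
apply: le_trans (_ : 1 - \sum_(i : option (bool * 'I_n)) 2 / n%:R ^+ 2 <= _).
  rewrite sumr_const card_option card_prod card_bool card_ord.
  rewrite -[_ *+ (2 * n).+1]mulr_natl.
  have -> : (2 * n).+1%:R = 2 * n%:R + 1 :> R by rewrite -natr1 natrM.
  have : (2 * n%:R + 1) * (2 / n%:R ^+ 2) <= 1 / 100 :> R.
    rewrite mulrA ler_pdivrMr ?exprn_gt0 //.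
    have : n%:R * 1000 <= n%:R * n%:R :> R by rewrite ler_pM2l // ltW.
    rewrite expr2; lra.
  lra.
by rewrite lerD2l lerN2; apply: ler_sum => i _; apply: P1.
Qed.
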